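(* Every GaTEx graph that contains no induced $4$-cycle $C_4$ is an interval graph, and hence a circular-arc graph.
   Context: All graphs are finite, simple and undirected. A galled-tree on a finite nonempty set $X$ is a directed acyclic graph $N=(V,E)$ such that either $V=X=\{x\}$ and $E=\emptyset$, or: (N1) there is a unique root with indegree 0 and outdegree at least 2; (N2) $x\in X$ iff $x$ has outdegree 0 and indegree 1; (N3) every non-root $v\in V\setminus X$ has either indegree 1 and outdegree at least 2, or indegree 2 and outdegree at least 1 (hybrid-vertex); (N4) each biconnected component $C$ of $N$ contains at most one hybrid-vertex whose two in-neighbours both belong to $C$. For $x,y\in X$, $\mathrm{lca}_N(x,y)$ is the (unique) minimal common ancestor of $x,y$. A labeled galled-tree $(N,t)$ has $t:V\to\{0,1,\odot\}$ with $t(x)=\odot$ iff $x\in X$; it explains the graph on $X$ where $\{x,y\}$ is an edge iff $t(\mathrm{lca}_N(x,y))=1$. A graph is GaTEx if it is isomorphic to a graph explained by some labeled galled-tree. An interval graph is the intersection graph of a family of intervals of a linearly ordered set; a circular-arc graph is the intersection graph of a family of arcs on a circle. *)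

(* Defs.v *)
From HB Require Import structures.
From mathcomp Require Import all_boot all_order all_algebra.
From mathcomp Require Import classical_sets reals trigo.

Set Implicit Arguments.
Unset Strict Implicit.
Unset Printing Implicit Defensive.

Import Order.TTheory GRing.Theory Num.Theory.

Record sgraph := SGraph {
  svertex :> finType;
  sedge : rel svertex;
  sedge_sym : symmetric sedge;
  sedge_irrefl : irreflexive sedge }.

Definition sgraph_iso (G H : sgraph) : Prop :=
  exists f : G -> H, bijective f /\
    forall x y, sedge (f x) (f y) = sedge x y.

Definition induced_subgraph (H G : sgraph) : Prop :=
  exists f : H -> G, injective f /\
    forall x y, sedge (f x) (f y) = sedge x y.

Definition C4_rel : rel 'I_4 :=
  [rel i j : 'I_4 | (i.+1 %% 4 == j) || (j.+1 %% 4 == i)].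

Fact C4_rel_sym : symmetric C4_rel.
Proof. by move=> i j; rewrite /C4_rel /= orbC. Qed.

Fact C4_rel_irrefl : irreflexive C4_rel.
Proof. by case=> [[|[|[|[|i]]]] lt_i]. Qed.

Definition C4 : sgraph := SGraph C4_rel_sym C4_rel_irrefl.

Section Digraph.

Variables (V : finType) (E : rel V).

Definition acyclic : Prop := forall c : seq V, cycle E c -> c = [::].

Definition in_nbrs (v : V) : {set V} := [set u | E u v].
Definition out_nbrs (v : V) : {set V} := [set u | E v u].
Definition indeg (v : V) : nat := #|in_nbrs v|.
Definition outdeg (v : V) : nat := #|out_nbrs v|.

Definition hybrid (v : V) : bool := (indeg v == 2) && (1 <= outdeg v).

(* Connectivity notions refer to the underlying undirected graph.  Maximal
   biconnected subgraphs are induced, hence given by their vertex sets; single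
   vertices and single edges count as biconnected. *)
Definition connected_in (S : {set V}) : bool :=
  [forall x in S, forall y in S,
    connect [rel u v | [&& u \in S, v \in S & E u v || E v u]] x y].

Definition biconnected (S : {set V}) : bool :=
  connected_in S && [forall v in S, connected_in (S :\ v)].

Definition biconnected_component (S : {set V}) : bool := maxset biconnected S.

Definition common_ancestor (x y v : V) : bool :=
  connect E v x && connect E v y.

(* v is below u when there is a directed path from u to v. *)
Definition min_common_ancestor (x y v : V) : bool :=
  common_ancestor x y v &&
  [forall u, common_ancestor x y u ==> connect E v u ==> (u == v)].

Definition is_lca (x y v : V) : bool :=
  [set u | min_common_ancestor x y u] == [set v].

Variable X : {set V}.

Definition single_vertex_tree : Prop :=
  exists x : V, [/\ [set: V] = [set x], X = [set x] & forall u v, ~~ E u v].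

Definition is_root (r : V) : Prop := indeg r = 0 /\ 2 <= outdeg r.

Definition N1 (r : V) : Prop := is_root r /\ forall r', is_root r' -> r' = r.

Definition N2 : Prop :=
  forall x, x \in X <-> outdeg x = 0 /\ indeg x = 1.

Definition N3 (r : V) : Prop :=
  forall v, v != r -> v \notin X ->
    (indeg v = 1 /\ 2 <= outdeg v) \/ hybrid v.

Definition N4 : Prop :=
  forall C : {set V}, biconnected_component C ->
    #|[set v in C | hybrid v & in_nbrs v \subset C]| <= 1.

Definition is_galled_tree : Prop :=
  [/\ X != finset.set0, acyclic &
      single_vertex_tree \/ exists r : V, [/\ N1 r, N2, N3 r & N4]].

End Digraph.

(* The labels 0, 1 and (.) are Some false, Some true and None. *)
Record labeled_galled_tree := LabeledGalledTree {
  gt_vertex : finType;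
  gt_arc : rel gt_vertex;
  gt_leaves : {set gt_vertex};
  gt_label : gt_vertex -> option bool;
  gt_axioms : is_galled_tree gt_arc gt_leaves;
  gt_labelP : forall v, gt_label v = None <-> v \in gt_leaves }.

Section ExplainedGraph.

Variable N : labeled_galled_tree.

Definition explained_rel : rel {x : gt_vertex N | x \in gt_leaves N} :=
  [rel x y | (x != y) &&
    [exists v, is_lca (@gt_arc N) (val x) (val y) v &&
               (gt_label v == Some true)]].

Fact explained_rel_sym : symmetric explained_rel.
Proof.
move=> x y; rewrite /explained_rel /= eq_sym; congr (_ && _).
have caC u v w : common_ancestor (@gt_arc N) u v w
               = common_ancestor (@gt_arc N) v u w by exact: andbC.
apply: eq_existsb => v; congr ((_ == _) && _); apply/setP => u.
rewrite !inE /min_common_ancestor caC; congr (_ && _).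
by apply: eq_forallb => w; rewrite caC.
Qed.

Fact explained_rel_irrefl : irreflexive explained_rel.
Proof. by move=> x; rewrite /explained_rel /= eqxx. Qed.

Definition explained_graph : sgraph :=
  SGraph explained_rel_sym explained_rel_irrefl.

End ExplainedGraph.

Definition GaTEx (G : sgraph) : Prop :=
  exists N : labeled_galled_tree, sgraph_iso G (explained_graph N).

Definition interval_graph (G : sgraph) : Prop :=
  exists (d : Order.disp_t) (T : orderType d) (I : G -> interval T),
    (forall x, exists z : T, z \in I x) /\
    (forall x y, x != y ->
       sedge x y <-> exists z : T, z \in I x /\ z \in I y).

Local Open Scope ring_scope.
Local Open Scope classical_set_scope.

(* Closed arcs of the unit circle; the full circle is excluded. *)
Definition circle_arc (R : realType) (A : set (R * R)) : Prop :=
  exists a b : R, [/\ a <= b, b - a < 2 * pi &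
    A = [set (cos s, sin s) | s in [set s : R | a <= s <= b]]].

Definition circular_arc_graph (R : realType) (G : sgraph) : Prop :=
  exists A : G -> set (R * R),
    (forall x, circle_arc (A x)) /\
    (forall x y, x != y -> sedge x y <-> A x `&` A y !=set0).

(* Main.v *)
(** A graph is an interval graph as soon as its vertices can be ordered so that,
    for every [x], the neighbours of [x] coming after [x] are consecutive right
    after [x].  Such an order is built by recursion along the galled-tree.

    By (N4) the descendants of a vertex are entered by at most two arcs: two
    cycles through a common arc would span one biconnected set with two hybrids.
    Hence the children of a vertex [v] fall into single branches and pairs
    forming a gall with top [v].  Distinct groups of leaves are completely joined
    or completely separated according to the label of [v]; a join without
    induced C4 has a complete side, whose vertices are placed first.

    In a gall, each of the two sides is a chain of modules, every module being
    joined to all later ones and to the part [h] below the hybrid, or to none of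
    them.  If the two sides are separated and [h] is complete, the orders of the
    sides are glued along [h]; if [h] is not complete, only one side may meet
    [h].  If the two sides are joined, one of them is complete, and its vertices
    are universal or see exactly the other side. *)

Require Import Defs.
From mathcomp Require Import classical_sets trigo.
From mathcomp Require Import all_boot all_order all_algebra zify lra.
From mathcomp Require Import reals.

Set Implicit Arguments.
Unset Strict Implicit.
Unset Printing Implicit Defensive.

Import Order.TTheory GRing.Theory Num.Theory.

(** * Interval orders *)

Section IntervalOrder.

Variables (T : eqType) (e : rel T).

(* The neighbours of each vertex among the later ones form an initial segment:
   the order of the left endpoints in an interval model. *)
Fixpoint iord (s : seq T) : bool :=
  if s is x :: s' then pairwise (fun y z => e x z ==> e x y) s' && iord s'
  else true.

Definition clique (s : seq T) : bool := all2rel (fun x y => (x == y) || e x y) s.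

(** The boolean stands for the label of the common lca, so that complete joins and disjoint unions
    are handled together. *)
Definition joined (b : bool) (s1 s2 : seq T) : bool :=
  allrel (fun x y => e x y == b) s1 s2.

Lemma pairwise_nbr x s : all (e x) s -> pairwise (fun y z => e x z ==> e x y) s.
Proof.
move=> /allP xs; apply/(pairwiseP x) => i j /(mem_nth x)/xs -> _ _.
by rewrite implybT.
Qed.

Lemma pairwise_nonnbr x s :
  all (fun y => ~~ e x y) s -> pairwise (fun y z => e x z ==> e x y) s.
Proof.
by move=> /allP xs; apply/(pairwiseP x) => i j _ /(mem_nth x)/xs/negPf ->.
Qed.

Lemma cliqueP s :
  reflect {in s &, forall x y, x != y -> e x y} (clique s).
Proof.
apply: (iffP allrelP) => cl x y xs ys.
  by move=> /negPf xy; have := cl x y xs ys; rewrite xy.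
by case: eqVneq => // /cl ->.
Qed.

Lemma cliquePn s :
  ~~ clique s -> exists x y, [/\ x \in s, y \in s, x != y & ~~ e x y].
Proof.
by case/allPn => x xs /allPn[y ys]; rewrite negb_or => /andP[xy exy]; exists x, y.
Qed.

Lemma clique_sub s1 s2 : {subset s1 <= s2} -> clique s2 -> clique s1.
Proof. by move=> ss /cliqueP cl; apply/cliqueP => x y /ss xs /ss ys; apply: cl. Qed.

Lemma iord_catl s1 s2 : iord (s1 ++ s2) -> iord s1.
Proof.
elim: s1 => //= x s1 IH /andP[+ /IH ->]; rewrite andbT pairwise_cat.
by case/and3P.
Qed.

(** Vertices of [a] and [b] see nothing of [s], and a vertex of [h] sees all of [b]. Inserting [b]
    between [h] and [s] therefore keeps every later neighbourhood an initial segment. This glues the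
    two sides of a gall along [h]. *)
Lemma iord_glue a h b s : iord (a ++ h ++ b) -> iord (h ++ s) ->
  joined true h b -> joined false (a ++ b) s -> iord (a ++ h ++ b ++ s).
Proof.
move=> io1 io2 hb; rewrite /joined allrel_catl => /andP[as_ bs].
have nonnbr c x : x \in c -> joined false c s -> all (fun y => ~~ e x y) s.
  by move=> xc /allrelP cs; apply/allP => y ys; rewrite (eqP (cs x y xc ys)).
elim: a as_ io1 => [|x a IH] /=.
  move=> _; elim: h hb io2 => [|x h IH] /=.
    move=> _ ios; elim: b bs => //= x b IH; rewrite /joined allrel_consl.
    case/andP=> xs bs /andP[pb iob]; rewrite IH // andbT pairwise_cat pb /=.
    rewrite pairwise_nonnbr ?andbT; last by apply: sub_all xs => y /eqP ->.
    by apply/allrelP => y z _ /(allP xs) /eqP ->.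
  rewrite /joined allrel_consl => /andP[xb hb] /andP[ps ios] /andP[pb iob].
  rewrite IH // andbT; move: ps pb; rewrite !pairwise_cat.
  case/and3P=> hs ph ps /and3P[hb' _ pb].
  rewrite allrel_catr hb' hs ph ps pb /= !andbT.
  by apply/allrelP => y z /(allP xb) /eqP ->; rewrite implybT.
rewrite /joined allrel_consl => /andP[xs as_] /andP[pb iob].
rewrite IH // andbT !catA pairwise_cat -!catA pb /=.
rewrite pairwise_nonnbr ?andbT; last by apply: sub_all xs => y /eqP ->.
by apply/allrelP => y z _ /(allP xs) /eqP ->.
Qed.

Lemma iord_disjoint_cat s1 s2 :
  iord s1 -> iord s2 -> joined false s1 s2 -> iord (s1 ++ s2).
Proof.
move=> io1 io2 j; apply: (@iord_glue s1 [::] [::] s2); rewrite ?cats0 //.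
Qed.

(** Each vertex of [k] first meets only neighbours, the rest of [k], so only its behaviour on [s]
    matters. *)
Lemma iord_clique_cat k s : uniq k -> clique k -> iord s ->
  {in k, forall x, pairwise (fun y z => e x z ==> e x y) s} -> iord (k ++ s).
Proof.
move=> + + ios; elim: k => //= x k IH /andP[xk uk] clk ps.
rewrite IH //; last 2 first.
- by apply: clique_sub clk => y yk; rewrite inE yk orbT.
- by move=> y yk; apply: ps; rewrite inE yk orbT.
have xy : all (e x) k.
  apply/allP => y yk; move/cliqueP: clk; apply; rewrite ?inE ?eqxx ?yk ?orbT //.
  by apply: contraNneq xk => ->.
rewrite andbT pairwise_cat pairwise_nbr //= ps ?mem_head // andbT.
by apply/allrelP => y z /(allP xy) ->; rewrite implybT.
Qed.

Lemma iord_join_cat k s : uniq k -> clique k -> iord s -> joined true k s ->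
  iord (k ++ s).
Proof.
move=> uk clk ios /allrelP ks; apply: iord_clique_cat => // x xk.
by apply: pairwise_nbr; apply/allP => y /(ks x y xk) /eqP.
Qed.

Lemma iord_insert h k s : uniq h -> clique h -> uniq k -> clique k ->
  joined true h k -> joined true k s -> iord (h ++ s) -> iord (h ++ k ++ s).
Proof.
move=> + + uk clk + ks; elim: h => [_ _ _ ios|x h IH] /=.
  exact: iord_join_cat.
rewrite /joined allrel_consl => /andP[xh uh] clh /andP[xk hk] /andP[ps ios].
rewrite IH //; last by apply: clique_sub clh => y yh; rewrite inE yh orbT.
have xk' : all (e x) k by apply: sub_all xk => y /eqP.
move: ps; rewrite !pairwise_cat andbT => /and3P[hs ph ps].
rewrite ph ps allrel_catr hs pairwise_nbr //= !andbT; apply/andP; split.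
  apply/allrelP => y z yh /(allP xk') xz; rewrite xz implyTb.
  move/cliqueP: clh; apply; rewrite ?inE ?eqxx ?yh ?orbT //.
  by apply: contraNneq xh => ->.
by apply/allrelP => y z /(allP xk') -> _; rewrite implybT.
Qed.

Hypothesis e_sym : symmetric e.

Lemma joined_sym b s1 s2 : joined b s1 s2 = joined b s2 s1.
Proof.
rewrite /joined allrelC; apply: eq_allrel => x y /=; by rewrite e_sym.
Qed.

Lemma joined_perm b s1 s2 t1 t2 : perm_eq s1 s2 -> perm_eq t1 t2 ->
  joined b s1 t1 = joined b s2 t2.
Proof. by move=> /perm_mem p1 /perm_mem p2; apply: eq_allrel_mem2. Qed.

Hypothesis C4_free : forall a b c d, e a b -> e b c -> e c d -> e d a ->
  a != c -> b != d -> e a c || e b d.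

(** A nonadjacent pair on each side, with the four cross edges, would be an induced 4-cycle. *)
Lemma join_clique s1 s2 : joined true s1 s2 -> clique s1 || clique s2.
Proof.
move=> /allrelP j; apply: contraT; rewrite negb_or => /andP[].
move=> /cliquePn[a [c [as1 cs1 ac eac]]] /cliquePn[b [d [bs2 ds2 bd ebd]]].
have /eqP ab := j a b as1 bs2; have /eqP cb := j c b cs1 bs2.
have /eqP ad := j a d as1 ds2; have /eqP cd := j c d cs1 ds2.
have := C4_free ab _ cd _ ac bd.
by rewrite (negPf eac) (negPf ebd) e_sym cb e_sym ad; apply.
Qed.

Lemma join_iord b s1 s2 : uniq (s1 ++ s2) -> iord s1 -> iord s2 ->
  joined b s1 s2 -> exists s, perm_eq s (s1 ++ s2) /\ iord s.
Proof.
rewrite cat_uniq => /and3P[u1 _ u2] io1 io2; case: b => j; last first.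
  by exists (s1 ++ s2); split=> //; apply: iord_disjoint_cat.
have /orP[cl|cl] := join_clique j.
  by exists (s1 ++ s2); split=> //; apply: iord_join_cat.
exists (s2 ++ s1); rewrite perm_catC; split=> //.
by apply: iord_join_cat; rewrite // joined_sym.
Qed.

(** * Orders for the sides of a gall and for whole galls *)

Definition chain_body (ch : seq (bool * seq T)) : seq T :=
  flatten [seq p.2 | p <- ch].

(* One side of a gall, listed from the top down: the leaves hanging off each
   vertex, paired with the label of that vertex; [h] lists the leaves below the
   hybrid. *)
Fixpoint chain (h : seq T) (ch : seq (bool * seq T)) : bool :=
  if ch is (b, m) :: ch' then
    [&& iord m, joined b m (chain_body ch' ++ h) & chain h ch']
  else true.

Lemma chain_hybrid h ch x y z : chain h ch -> x \in chain_body ch ->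
  y \in h -> z \in h -> e x y = e x z.
Proof.
elim: ch => //= -[b m] ch IH /and3P[_ /allrelP j chh].
rewrite /chain_body /= mem_cat => /orP[xm|xch] yh zh; last exact: IH.
by rewrite (eqP (j x y xm _)) ?(eqP (j x z xm _)) // mem_cat ?yh ?zh orbT.
Qed.

(** The top-down order works as it stands: a module joined to everything later is complete, the
    others see nothing later. *)
Lemma chain_iord h ch : uniq (chain_body ch) -> iord h -> chain h ch ->
  all (fun p => p.1 ==> clique p.2) ch -> iord (chain_body ch ++ h).
Proof.
move=> + ioh; elim: ch => //= -[b m] ch IH /= u /and3P[iom j chh] /andP[bm cl].
rewrite /chain_body /= -catA.
have /and3P[um _ uch] : [&& uniq m, ~~ has (mem m) (chain_body ch)
    & uniq (chain_body ch)] by rewrite -cat_uniq.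
case: b {u} j bm => j; last by move=> _; apply: iord_disjoint_cat => //; apply: IH.
by move=> /= clm; apply: iord_join_cat => //; apply: IH.
Qed.

(** A module labelled 1 is joined to the nonadjacent pair [x], [y], so by [join_clique] it must be
    complete. *)
Lemma chain_labels_clique h ch x y : chain h ch -> x \in h -> y \in h ->
  x != y -> ~~ e x y -> all (fun p => p.1 ==> clique p.2) ch.
Proof.
move=> + xh yh xy exy; elim: ch => //= -[[] m] ch IH /= /and3P[_ j chh];
  rewrite IH // andbT.
have /orP[//|/cliqueP cl] := join_clique j.
by have := cl x y; rewrite !mem_cat xh yh !orbT (negPf exy) xy => /(_ isT isT isT).
Qed.

(** The side is wrapped around [h] from the bottom up, modules going to the front whenever possible.
    The part [b] behind [h] must be joined to [h], as [iord_glue] requires. *)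
Lemma chain_left h ch : uniq (chain_body ch ++ h) -> clique h -> iord h ->
  chain h ch -> exists a b, [/\ perm_eq (a ++ b) (chain_body ch),
    joined true h b & iord (a ++ h ++ b)].
Proof.
move=> + clh ioh; elim: ch => [_ _|[b m] ch IH] /=.
  by exists [::], [::]; rewrite /= cats0 /joined allrel0r.
rewrite /chain_body /= -/(chain_body ch) -catA => u.
have := u; rewrite cat_uniq => /and3P[um _ uch].
move=> /and3P[iom j chh]; have [a [c [pac hc io]]] := IH uch chh.
have pj : perm_eq (a ++ h ++ c) (chain_body ch ++ h).
  apply/permP => p; move/permP: pac => /(_ p); rewrite !count_cat; clear; lia.
have j' : joined b m (a ++ h ++ c) by rewrite (joined_perm _ (perm_refl _) pj).
have pmac : perm_eq ((m ++ a) ++ c) (m ++ chain_body ch).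
  by rewrite -catA perm_cat2l.
case: b {u} j j' => j j'; last first.
  by exists (m ++ a), c; split=> //; rewrite -!catA; apply: iord_disjoint_cat.
have /orP[cl|cl] := join_clique j.
  by exists (m ++ a), c; split=> //; rewrite -!catA; apply: iord_join_cat.
(* Here everything below [m] is complete, so it can be reordered freely: [h] comes first and [m],
   perhaps not complete, last. *)
exists [::], (chain_body ch ++ m); split=> /=.
- by rewrite perm_catC.
- rewrite /joined allrel_catr; apply/andP; split; last first.
    move: j; rewrite /joined allrel_catr => /andP[_ mh].
    by rewrite -[allrel _ h m]/(joined true h m) joined_sym.
  apply/allrelP => x y xh yc; apply/eqP; move/cliqueP: cl; apply.
  - by rewrite mem_cat xh orbT.
  - by rewrite mem_cat yc.
  - move: uch; rewrite cat_uniq => /and3P[_ /hasPn /(_ x xh) /= xc _].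
    by apply: contraNneq xc => ->.
- rewrite catA; apply: iord_join_cat => //.
  - by rewrite uniq_catC.
  - by apply: clique_sub cl => x; rewrite !mem_cat orbC.
  - by rewrite joined_sym; move: j; rewrite /joined !allrel_catr andbC.
Qed.

(** Now [h] has to stay in front. A module labelled 0 is appended at the end, a complete module
    labelled 1 is inserted right after [h], and any other module forces all the rest to be complete
    and goes last. *)
Lemma chain_right h ch : uniq (chain_body ch ++ h) -> clique h -> iord h ->
  chain h ch -> exists s, perm_eq s (chain_body ch) /\ iord (h ++ s).
Proof.
move=> + clh ioh; elim: ch => [_ _|[b m] ch IH] /=.
  by exists [::]; rewrite cats0.
rewrite /chain_body /= -/(chain_body ch) -catA => u.
have := u; rewrite cat_uniq => /and3P[um _ uch].
move=> /and3P[iom j chh]; have [s [ps io]] := IH uch chh.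
have pj : perm_eq (h ++ s) (chain_body ch ++ h) by rewrite perm_catC perm_cat2r.
have uh : uniq h by move: uch; rewrite cat_uniq => /and3P[].
have j' : joined b m (h ++ s) by rewrite (joined_perm _ (perm_refl _) pj).
have psm : perm_eq (s ++ m) (m ++ chain_body ch) by rewrite perm_catC perm_cat2l.
case: b {u} j j' => j j'; last first.
  exists (s ++ m); split=> //; rewrite catA.
  by apply: iord_disjoint_cat => //; rewrite joined_sym.
have /orP[cl|cl] := join_clique j.
  exists (m ++ s); split; first by rewrite perm_cat2l.
  move: j'; rewrite /joined allrel_catr => /andP[mh ms].
  by apply: iord_insert => //; rewrite joined_sym.
exists (s ++ m); split=> //; rewrite catA; apply: iord_join_cat => //.
- by rewrite (perm_uniq pj).
- by apply: clique_sub cl => x; rewrite (perm_mem pj).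
- by rewrite joined_sym.
Qed.

(** By [chain_hybrid] a vertex of the complete side [w] sees all of [h] or none of it. The former
    are universal and come first; the latter see all of [v], all of [w] and nothing of [h], so they
    precede [v ++ h]. *)
Lemma gall_join_iord h c1 c2 :
  uniq (chain_body c1 ++ chain_body c2 ++ h) -> iord h ->
  chain h c1 -> chain h c2 -> joined true (chain_body c1) (chain_body c2) ->
  clique (chain_body c2) ->
  exists s, perm_eq s (chain_body c1 ++ chain_body c2 ++ h) /\ iord s.
Proof.
set v := chain_body c1; set w := chain_body c2 => u ioh ch1 ch2 j clw.
have /and4P[uv uw uh uvh] : [&& uniq v, uniq w, uniq h & uniq (v ++ h)].
  apply/and4P; split; first by move: u; rewrite cat_uniq => /and3P[].
  - by move: u; rewrite !cat_uniq => /and3P[_ _ /and3P[]].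
  - by move: u; rewrite !cat_uniq => /and3P[_ _ /and3P[]].
  - move: u; rewrite uniq_catCA cat_uniq => /and3P[_ _] //.
pose f x := all (e x) h.
have j' : joined true w v by rewrite joined_sym.
have [s [ps ios js]] : exists s, [/\ perm_eq s (filter (predC f) w ++ v ++ h),
    iord s & joined true (filter f w) s].
  (* The vertices selected by [f] are universal, so only the remaining ones need an order. *)
  suff [s [ps ios]] : exists s,
      perm_eq s (filter (predC f) w ++ v ++ h) /\ iord s.
    exists s; split=> //; rewrite (joined_perm _ (perm_refl _) ps).
    rewrite /joined !allrel_catr; apply/and3P; split.
    - apply/allrelP => x y; rewrite !mem_filter => /andP[fx xw] /andP[fy yw].
      apply/eqP; move/cliqueP: clw; apply=> //.
      by apply: contraTneq fx => ->.
    - apply/allrelP => x y; rewrite mem_filter => /andP[_ xw].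
      exact: (allrelP j').
    - apply/allrelP => x y; rewrite mem_filter => /andP[/allP fx _] /fx.
      by move=> ->.
  case E: (filter (predC f) w) => [|k s] /=.
    have [clh|/cliquePn[x [y [xh yh xy exy]]]] := boolP (clique h).
      have [a [b [pab _ io]]] := chain_left uvh clh ioh ch1.
      exists (a ++ h ++ b); split=> //.
      apply/permP => p; move/permP: pab => /(_ p); rewrite !count_cat.
      by rewrite -/v; clear; lia.
    exists (v ++ h); split=> //; apply: chain_iord => //.
    exact: (chain_labels_clique ch1 xh yh xy exy).
  rewrite -cat_cons -E; exists (filter (predC f) w ++ v ++ h); split=> //.
  have nadj x y : x \in filter (predC f) w -> y \in h -> e x y = false.
    rewrite mem_filter => /andP[/= /allPn[z zh /negPf xz] xw] yh.
    by rewrite (chain_hybrid ch2 xw yh zh).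
  apply: iord_clique_cat; first exact: filter_uniq.
  - by apply: clique_sub clw => x; rewrite mem_filter => /andP[].
  - apply: chain_iord => //.
    have kK : k \in filter (predC f) w by rewrite E mem_head.
    have := kK; rewrite mem_filter => /andP[/= /allPn[z zh xz] kw].
    (* A leaf of [w] missing [h] forces every dominating module to be a clique. *)
    have : {subset v <= v} by [].
    rewrite {1}/v; elim: (c1) ch1 => //= -[b m] ch IH /and3P[_ jm chh].
    rewrite /chain_body /= -/(chain_body ch) => sub.
    rewrite IH ?andbT //; last by move=> x xc; apply: sub; rewrite mem_cat xc orbT.
    case: b jm => //= jm.
    have /join_clique/orP[//|/cliqueP cl] : joined true m [:: k; z].
      apply/allrelP => x y xm; rewrite !inE => /orP[]/eqP->.
        rewrite e_sym; apply: (allrelP j') => //.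
        by apply: sub; rewrite mem_cat xm.
      by apply: (allrelP jm) => //; rewrite mem_cat zh orbT.
    have := cl k z; rewrite !inE !eqxx orbT (negPf xz); case: eqVneq => [kz|_].
      have /hasPn/(_ z zh) /= : ~~ has (mem w) h.
        by move: u; rewrite !cat_uniq => /and3P[_ _ /and3P[]].
      by rewrite -kz kw.
    by move=> /(_ isT isT isT).
  (* In [v ++ h] the neighbours of [x] are exactly the initial part [v]. *)
  - move=> x xK; rewrite pairwise_cat pairwise_nbr; last first.
      apply/allP => y yv; apply/eqP; apply: (allrelP j') => //.
      by move: xK; rewrite mem_filter => /andP[].
    rewrite pairwise_nonnbr ?andbT; last by apply/allP => y yh; rewrite nadj.
    by apply/allrelP => y z _ zh; rewrite nadj.
exists (filter f w ++ s); split.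
  apply/permP => p; move/permP: ps => /(_ p); rewrite !count_cat.
  have /permPl := perm_filterC f w => /permP /(_ p).
  rewrite count_cat; clear; lia.
apply: iord_join_cat => //; first exact: filter_uniq.
by apply: clique_sub clw => x; rewrite mem_filter => /andP[].
Qed.

Lemma gall_disjoint_iord h c1 c2 :
  uniq (chain_body c1 ++ chain_body c2 ++ h) -> iord h ->
  chain h c1 -> chain h c2 -> joined false (chain_body c1) (chain_body c2) ->
  all (fun p => p.1 ==> clique p.2) c1 -> all (fun p => p.1 ==> clique p.2) c2 ->
  joined false (chain_body c2) h ->
  exists s, perm_eq s (chain_body c1 ++ chain_body c2 ++ h) /\ iord s.
Proof.
move=> u ioh ch1 ch2 j cl1 cl2 jh.
exists ((chain_body c1 ++ h) ++ chain_body c2); split.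
  by apply/permP => p; rewrite !count_cat; clear; lia.
apply: iord_disjoint_cat.
- apply: chain_iord => //; by move: u; rewrite cat_uniq => /and3P[].
(* An order of the second side alone is a prefix of its order followed by [h]. *)
- apply: (@iord_catl _ h); apply: chain_iord => //.
  by move: u; rewrite !cat_uniq => /and3P[_ _ /and3P[]].
- rewrite /joined allrel_catl; apply/andP; split=> //.
  by rewrite -/(joined _ _ _) joined_sym.
Qed.

Lemma chain_joined_hybrid h ch : chain h ch ->
  joined false (chain_body ch) h
  \/ exists2 x, x \in chain_body ch & {in h, forall y, e x y}.
Proof.
case: h => [|y0 h]; first by left; rewrite /joined allrel0r.
move=> chh; have [jf|/allPn[x xc /allPn[y yh exy]]] :=
  boolP (joined false (chain_body ch) (y0 :: h)); [by left|right].
exists x => // z zh; rewrite (chain_hybrid chh xc zh yh).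
by move: exy; case: (e x y).
Qed.

Lemma gall_iord b h c1 c2 :
  uniq (chain_body c1 ++ chain_body c2 ++ h) -> iord h ->
  chain h c1 -> chain h c2 -> joined b (chain_body c1) (chain_body c2) ->
  exists s, perm_eq s (chain_body c1 ++ chain_body c2 ++ h) /\ iord s.
Proof.
move=> u ioh ch1 ch2 j.
have pC : perm_eq (chain_body c2 ++ chain_body c1 ++ h)
    (chain_body c1 ++ chain_body c2 ++ h) by rewrite perm_catCA.
have u' : uniq (chain_body c2 ++ chain_body c1 ++ h) by rewrite (perm_uniq pC).
have j' : joined b (chain_body c2) (chain_body c1) by rewrite joined_sym.
case: b j j' => j j'.
  have /orP[cl|cl] := join_clique j; last exact: gall_join_iord.
  have [s [ps ios]] := gall_join_iord u' ioh ch2 ch1 j' cl.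
  by exists s; split=> //; apply: perm_trans ps pC.
have [clh|/cliquePn[x [y [xh yh xy exy]]]] := boolP (clique h).
  have u1 : uniq (chain_body c1 ++ h).
    by move: u'; rewrite cat_uniq => /and3P[].
  have u2 : uniq (chain_body c2 ++ h).
    by move: u; rewrite cat_uniq => /and3P[].
  have [a [b [pab hb io1]]] := chain_left u1 clh ioh ch1.
  have [s [ps io2]] := chain_right u2 clh ioh ch2.
  exists (a ++ h ++ b ++ s); split.
    apply/permP => p; move/permP: pab => /(_ p); move/permP: ps => /(_ p).
    rewrite !count_cat; clear; lia.
  by apply: iord_glue; rewrite // (joined_perm _ pab ps).
have cl1 := chain_labels_clique ch1 xh yh xy exy.
have cl2 := chain_labels_clique ch2 xh yh xy exy.
have [jh|[z2 z2c z2h]] := chain_joined_hybrid ch2.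
  exact: gall_disjoint_iord.
have [jh|[z1 z1c z1h]] := chain_joined_hybrid ch1.
  have [s [ps ios]] := gall_disjoint_iord u' ioh ch2 ch1 j' cl2 cl1 jh.
  by exists s; split=> //; apply: perm_trans ps pC.
(* If both sides see [h], then [z1], [x], [z2], [y] form an induced 4-cycle. *)
have nz : e z1 z2 = false by apply/eqP; apply: (allrelP j).
have z12 : z1 != z2.
  have /hasPn/(_ z2) : ~~ has (mem (chain_body c1)) (chain_body c2 ++ h).
    by move: u; rewrite cat_uniq => /and3P[].
  rewrite mem_cat z2c => /(_ isT); apply: contraNneq => <- //.
have := C4_free (z1h x xh) _ (z2h y yh) _ z12 xy.
by rewrite nz (negPf exy) e_sym z2h // e_sym z1h // => /(_ isT isT).
Qed.

End IntervalOrder.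

(** * Entering arcs of descendant sets *)

Section Biconnectivity.

Variables (V : finType) (E : rel V).

Let adj : rel V := [rel u v | E u v || E v u].
Let adj_in (S : {set V}) : rel V :=
  [rel u v | [&& u \in S, v \in S & E u v || E v u]].

Lemma connected_inP (S : {set V}) :
  reflect {in S &, forall x y, connect (adj_in S) x y} (connected_in E S).
Proof.
apply: (iffP forall_inP) => [cS x y xS yS | cS x xS].
  by have /forall_inP/(_ y yS) := cS x xS.
by apply/forall_inP => y yS; apply: cS.
Qed.

Lemma adj_in_connect_sym (S : {set V}) : connect_sym (adj_in S).
Proof. by apply: sym_connect_sym => x y; rewrite /adj_in /= orbC andbCA. Qed.

Lemma adj_in_connectS (S S' : {set V}) : S \subset S' ->
  subrel (connect (adj_in S)) (connect (adj_in S')).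
Proof.
move=> /subsetP sub; apply: connect_sub => x y /and3P[xS yS xy].
by apply: connect1; rewrite /adj_in /= !sub.
Qed.

Lemma connected_inU (S1 S2 : {set V}) z : z \in S1 -> z \in S2 ->
  connected_in E S1 -> connected_in E S2 -> connected_in E (S1 :|: S2).
Proof.
move=> z1 z2 /connected_inP c1 /connected_inP c2.
have cz x : x \in S1 :|: S2 -> connect (adj_in (S1 :|: S2)) x z.
  case/setUP => xS; first by apply: (adj_in_connectS (subsetUl S1 S2)); apply: c1.
  by apply: (adj_in_connectS (subsetUr S1 S2)); apply: c2.
apply/connected_inP => x y xS yS; apply: connect_trans (cz x xS) _.
by rewrite adj_in_connect_sym cz.
Qed.

(** Deleting a vertex outside [S] changes nothing, so [z] may range over all vertices. *)
Lemma biconnectedP (S : {set V}) :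
  reflect (connected_in E S /\ forall z, connected_in E (S :\ z))
          (biconnected E S).
Proof.
apply: (iffP andP) => -[cS cSz]; split=> //; last first.
  by apply/forall_inP => z _; apply: cSz.
move=> z; have [zS|zS] := boolP (z \in S); first by move/forall_inP: cSz; apply.
by rewrite (setDidPl _) // disjoint_sym disjoints1.
Qed.

(** After the deletion of any one vertex, [u] or [v] is still common to both sets. *)
Lemma biconnectedU (S1 S2 : {set V}) u v : u != v ->
  u \in S1 -> u \in S2 -> v \in S1 -> v \in S2 ->
  biconnected E S1 -> biconnected E S2 -> biconnected E (S1 :|: S2).
Proof.
move=> uv u1 u2 v1 v2 /biconnectedP[c1 d1] /biconnectedP[c2 d2].
apply/biconnectedP; split=> [|z]; first exact: connected_inU u1 u2 c1 c2.
rewrite setDUl; have [uz|uz] := eqVneq u z.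
  by apply: (@connected_inU _ _ v); rewrite // !inE -uz eq_sym uv.
by apply: (@connected_inU _ _ u); rewrite // !inE uz.
Qed.

Lemma path_connected_in x s : path adj x s -> connected_in E [set y in x :: s].
Proof.
set S := [set y in _] => xs.
have pS : path (adj_in S) x s.
  apply: (@sub_in_path _ (mem S) adj (adj_in S) _ x s) xs => [y z yS zS /= yz|].
    by apply/and3P; split.
  by apply/allP => y ys; change (y \in S); rewrite in_set.
apply/connected_inP => y z; rewrite !in_set => ys zs.
apply: (@connect_trans _ _ x); last exact: path_connect zs.
rewrite adj_in_connect_sym; exact: path_connect ys.
Qed.

Lemma cycle_biconnected (c : seq V) :
  cycle adj c -> uniq c -> biconnected E [set x in c].
Proof.
move=> cc uc; apply/biconnectedP; split=> [|z].
  case: c cc {uc} => [_|x s].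
    by apply/connected_inP => x y; rewrite inE.
  by rewrite /cycle rcons_path => /andP[/path_connected_in].
have [zc|zc] := boolP (z \in c); last first.
  rewrite (setDidPl _); last by rewrite disjoint_sym disjoints1 inE.
  case: c cc {uc zc} => [_|x s].
    by apply/connected_inP => x y; rewrite inE.
  by rewrite /cycle rcons_path => /andP[/path_connected_in].
(* Rotating the cycle so that [z] comes first shows that the rest is a path. *)
case/rot_to: zc => i s rc.
have -> : [set x in c] :\ z = [set x in s].
  apply/setP => x; rewrite !inE -(mem_rot i) rc inE.
  case: eqVneq => //= ->; apply/esym/negbTE.
  by move: uc; rewrite -(rot_uniq i) rc => /andP[].
move: cc; rewrite -(rot_cycle i) rc /=.
case: s {rc} => [_|y s]; first by apply/connected_inP => x y; rewrite inE.
by rewrite /= rcons_path => /and3P[_ /path_connected_in].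
Qed.

End Biconnectivity.

(** * Reachability in acyclic digraphs *)

Section Acyclic.

Variables (V : finType) (E : rel V).
Hypothesis E_acyclic : acyclic E.

Local Notation reach := (connect E).

Lemma reach_anti u v : reach u v -> reach v u -> u = v.
Proof.
move=> /connectP[p up ->] /connectP[q vq uq].
case/lastP pq: (p ++ q) => [|s z].
  by move: pq; case: (p).
have pu : path E u (p ++ q) by rewrite cat_path up.
have zu : z = u by have := last_cat u p q; rewrite pq last_rcons -uq.
by have := E_acyclic (c := u :: s); rewrite /cycle -{1}zu -zu -pq zu => /(_ pu).
Qed.

Lemma arcNreach u v : E u v -> ~~ reach v u.
Proof.
move=> uv; apply/negP => vu.
have uE := reach_anti (connect1 uv) vu; rewrite uE in uv.
by have := E_acyclic (c := [:: v]); rewrite /= uv => /(_ isT).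
Qed.

(** The arc is the first one on a path from [x] to [z] that enters [S]. With [S] a descendant set,
    this is how entering arcs are found. *)
Lemma reach_enter (S : pred V) x z : reach x z -> ~~ S x -> S z ->
  exists a b, [/\ reach x a, E a b, reach b z, ~~ S a & S b].
Proof.
move=> /connectP[p]; elim: p x => [x _ -> /negP //|y p IH] x /= /andP[xy yp] zE.
move=> Sx Sz; have [Sy|Sy] := boolP (S y).
  exists x, y; split=> //; last by apply/connectP; exists p.
have [a [b [ya ab bz Sa Sb]]] := IH y yp zE Sy Sz; exists a, b; split=> //.
exact: connect_trans (connect1 xy) ya.
Qed.

Lemma reach_last x z : reach x z -> x != z -> exists2 y, reach x y & E y z.
Proof.
move=> xz nxz; have [] := @reach_enter (pred1 z) x z xz nxz (eqxx z).
by move=> a [b [xa ab _ _ /eqP <-]]; exists a.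
Qed.

Lemma reach_first x z : reach x z -> x != z -> exists2 y, E x y & reach y z.
Proof.
move=> /connectP[[|y p] /= xp ->]; first by rewrite eqxx.
by case/andP: xp => xy yp _; exists y => //; apply/connectP; exists p.
Qed.

(** A vertex of [I] with fewest ancestors works: by [reach_anti], a proper ancestor has strictly
    fewer. *)
Lemma reach_source (I : pred V) x :
  I x -> exists2 b, I b & forall a, I a -> reach a b -> a = b.
Proof.
move=> Ix; case: (@arg_minnP _ x I (fun b => #|[set w | reach w b]|) Ix).
move=> b Ib bmin; exists b => // a Ia ab; apply/eqP; apply: contraT => nab.
have /bmin := Ia; rewrite leqNgt => /negP[]; apply: proper_card.
apply/properP; split.
  by apply/subsetP => w; rewrite !inE => /connect_trans; apply.
exists b; rewrite !inE ?connect0 //; apply: contraNN nab => ba.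
by rewrite (reach_anti ab ba).
Qed.

Lemma reach_sink (I : pred V) x :
  I x -> exists2 b, I b & forall a, I a -> reach b a -> a = b.
Proof.
move=> Ix; case: (@arg_minnP _ x I (fun b => #|[set w | reach b w]|) Ix).
move=> b Ib bmin; exists b => // a Ia ab; apply/eqP; apply: contraT => nab.
have /bmin := Ia; rewrite leqNgt => /negP[]; apply: proper_card.
apply/properP; split.
  by apply/subsetP => w; rewrite !inE; apply: connect_trans.
exists b; rewrite !inE ?connect0 //; apply: contraNN nab => ba.
by rewrite (reach_anti ab ba).
Qed.

Lemma reach_path x y : reach x y -> exists p, [/\ path E x p, last x p = y,
  uniq (x :: p) & {in x :: p, forall w, reach x w /\ reach w y}].
Proof.
move=> /connectP[p0 + ->] => /shortenP[p xp up _]; exists p; split=> // w wp.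
split; first exact: path_connect wp.
case/splitPl: wp xp {up} => p1 p2 <-; rewrite cat_path last_cat => /andP[_ p2p].
by apply/connectP; exists p2.
Qed.

(* The undirected cycle runs from a lowest common ancestor of [u] and [a] down to
   [u], through the arc [(u, v)] to [b], and back up along [(a, b)]. *)
Lemma entering_arc_cycle r u v a b : reach r u -> reach r a -> E u v -> E a b ->
  ~~ reach v a -> reach v b -> (a, b) != (u, v) ->
  exists S : {set V}, [/\ biconnected E S, [/\ u \in S, v \in S & b \in S] &
    exists q, [/\ q \in S, E q b, q != a & a \in S]].
Proof.
move=> ru ra uv ab va vb nabuv.
have [p /= /andP[pu pa] pmin] :=
  @reach_sink (fun w => reach w u && reach w a) r (introT andP (conj ru ra)).
have [s [ps lsu us sP]] := reach_path pu.
have [t [pt lta ut tP]] := reach_path pa.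
have [q [pq lqb uq qP]] := reach_path vb.
pose c := p :: s ++ (v :: q) ++ rev t.
have cE x : (x \in c) = [|| x \in p :: s, x \in v :: q | x \in t].
  by rewrite /c -cat_cons !mem_cat mem_rev.
(* A vertex above [u] and below [v] would close a directed cycle through [(u, v)]; one above [a] and
   below [v] would make [a] reachable from [v]. So the path from [v] avoids the two others. *)
have nvu w : reach w u -> ~~ (w \in v :: q).
  move=> wu; apply: contraL (arcNreach uv) => /qP[vw _]; rewrite negbK.
  exact: connect_trans vw wu.
have nva w : reach w a -> ~~ (w \in v :: q).
  by move=> wa; apply: contraNN va => /qP[vw _]; apply: connect_trans vw wa.
have ta w : w \in t -> reach w a.
  by move=> wt; have [|_ //] := tP w; rewrite inE wt orbT.
have uc : uniq c.
  rewrite /c -cat_cons cat_uniq us cat_uniq uq rev_uniq.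
  have /andP[pnt ut'] : (p \notin t) && uniq t := ut.
  rewrite ut' !andTb andbT; apply/andP; split; last first.
    by rewrite has_rev; apply/hasPn => w wt; apply: nva; apply: ta.
  rewrite has_cat negb_or.
  apply/andP; split; apply/hasPn => w /=.
    by apply: contraL => /sP[_ wu]; apply: nvu.
  rewrite mem_rev => wt; apply: contraNN pnt => /sP[pw wu].
  by rewrite -(pmin w) // wu ta.
have cc : cycle [rel x y | E x y || E y x] c.
  have sE : subrel E [rel x y | E x y || E y x] by move=> x y /= ->.
  rewrite /c /= rcons_cat cat_path (sub_path sE ps) /= lsu uv /=.
  rewrite rcons_cat cat_path (sub_path sE pq) lqb /=.
  (* The way back starts at [a], also when [t] is empty and [a] is [p]. *)
  have -> : rcons (rev t) p = a :: rev (belast p t).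
    by rewrite -rev_cons lastI rev_rcons lta.
  rewrite /= ab orbT /= -lta rev_path.
  by apply: sub_path pt => x y /= ->; rewrite orbT.
exists [set x in c]; split; first exact: cycle_biconnected.
  rewrite !inE -!in_cons -?cat_cons !cE -{1}lsu mem_last mem_head orbT.
  by rewrite -lqb mem_last orbT.
have aS : a \in [set x in c].
  rewrite inE cE -lta; have := mem_last p t; rewrite inE => /orP[/eqP ->|->].
    by rewrite mem_head.
  by rewrite !orbT.
(* The second in-neighbour of [b] on the cycle is [u] if [v] is [b], and otherwise the last but one
   vertex of the path from [v], which is not [a] because [v] does not reach [a]. *)
have [vbE|vbN] := eqVneq v b.
  exists u; split; rewrite // -?vbE //.
    by rewrite inE cE -lsu mem_last.
  by move: nabuv; rewrite -vbE xpair_eqE eqxx andbT eq_sym.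
case/lastP: q pq lqb uq qP @c cE nvu nva uc cc aS => [|q z].
  by move=> _ /= vbE; rewrite vbE eqxx in vbN.
rewrite rcons_path last_rcons => /andP[pq ez] zb uq qP c cE _ nva _ _ aS.
rewrite zb in ez; exists (last v q); split=> //.
  by rewrite inE cE -rcons_cons mem_rcons in_cons mem_last !orbT.
apply: contraNneq va => <-; apply/connectP; exists q => //.
Qed.

End Acyclic.

(** * Consequences of the galled-tree axioms *)

Section GalledTree.

Variables (V : finType) (E : rel V) (X : {set V}) (r : V).
Hypothesis E_acyclic : acyclic E.
Hypotheses (rN1 : N1 E r) (XN2 : N2 E X) (rN3 : N3 E X r) (EN4 : N4 E).

Local Notation reach := (connect E).

Lemma indeg_leaf x : x \in X -> indeg E x = 1.
Proof. by move/XN2 => []. Qed.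

(** A topmost ancestor of [v] has indegree 0, which (N2) and (N3) allow for the root only. *)
Lemma root_reach v : reach r v.
Proof.
have [b bv bsrc] := reach_source E_acyclic (I := fun w => reach w v) (connect0 E v).
suff <- : b = r by [].
apply/eqP; apply: contraT => br.
have b0 : indeg E b = 0.
  apply/eqP; rewrite cards_eq0; apply/eqP/setP => a; rewrite !inE.
  apply/negbTE/negP => ab.
  have aE : a = b.
    by apply: bsrc (connect1 ab); apply: connect_trans (connect1 ab) bv.
  by have := arcNreach E_acyclic ab; rewrite aE connect0.
have bX : b \notin X by apply/negP => /indeg_leaf; rewrite b0.
by case: (rN3 br bX) => [[]|/andP[/eqP]]; rewrite b0.
Qed.

(** Two in-neighbours exclude the root and the leaves, and (N3) bounds the indegree by two. *)
Lemma hybrid_of_arcs a q b : E a b -> E q b -> q != a ->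
  hybrid E b /\ in_nbrs E b = [set a; q].
Proof.
move=> ab qb qa.
have sub : [set a; q] \subset in_nbrs E b.
  by apply/subsetP => x; rewrite !inE => /orP[]/eqP->.
have le2 : 2 <= indeg E b.
  by have := subset_leq_card sub; rewrite cards2 eq_sym qa.
have bX : b \notin X by apply/negP => /indeg_leaf; move: le2; rewrite /indeg; lia.
have br : b != r.
  apply: contraTneq le2 => ->; have [[-> _] _] := rN1; by [].
case: (rN3 br bX) => [[b1]|hb]; first by rewrite b1 in le2.
split=> //; apply/esym/eqP; rewrite eqEcard sub cards2 eq_sym qa /=.
by move: hb => /andP[/eqP]; rewrite /indeg => -> _.
Qed.

(* Two such arcs would give two cycles through [(u, v)], hence one biconnected
   component with two hybrids. *)
Lemma entering_arc_unique u v a b a' b' : E u v ->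
  E a b -> ~~ reach v a -> reach v b -> (a, b) != (u, v) ->
  E a' b' -> ~~ reach v a' -> reach v b' -> (a', b') != (u, v) ->
  (a, b) = (a', b').
Proof.
move=> uv ab va vb nab ab' va' vb' nab'.
have [S [bS [uS vS bbS] [q [qS qb qa aS]]]] :=
  entering_arc_cycle E_acyclic (root_reach u) (root_reach a) uv ab va vb nab.
have [S' [bS' [uS' vS' bbS'] [q' [qS' qb' qa' aS']]]] :=
  entering_arc_cycle E_acyclic (root_reach u) (root_reach a') uv ab' va' vb' nab'.
have uNv : u != v.
  by apply: contraTneq (arcNreach E_acyclic uv) => ->; rewrite connect0.
have [hb nb] := hybrid_of_arcs ab qb qa.
have [hb' nb'] := hybrid_of_arcs ab' qb' qa'.
have [C Cmax subC] :=
  maxset_exists (biconnectedU uNv uS uS' vS vS' bS bS').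
have [sSC sSC'] : {subset S <= C} /\ {subset S' <= C}.
  by split=> x xS; move/subsetP: subC; apply; rewrite inE xS ?orbT.
have eb : b = b'.
  have /card_le1_eqP := EN4 Cmax; apply; rewrite inE.
    rewrite (sSC' b' bbS') hb' nb'; apply/subsetP => x /set2P[]->; exact: sSC'.
  rewrite (sSC b bbS) hb nb; apply/subsetP => x /set2P[]->; exact: sSC.
(* With distinct tails, [a] and [a'] are all in-neighbours of [b]. But [u], if [v] is [b], or else
   the last vertex before [b] on a path from [v], would be a third one. *)
rewrite -eb; congr (_, _); apply/eqP; apply: contraT => aa'.
rewrite -{}eb in ab' vb' qb' nb' nab' *.
have [_ nbb] := hybrid_of_arcs ab' ab aa'.
have [vbE|vbN] := eqVneq v b.
  have : u \in in_nbrs E b by rewrite inE -vbE.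
  rewrite nbb => /set2P[]uE; first by rewrite uE vbE eqxx in nab'.
  by rewrite uE vbE eqxx in nab.
have [y vy yb] := reach_last vb vbN.
have : y \in in_nbrs E b by rewrite inE.
by rewrite nbb => /set2P[]yE; rewrite yE in vy; rewrite vy in va va'.
Qed.

End GalledTree.

(** * Recursion along the network *)

Section Decomposition.

Variables (V : finType) (E : rel V) (X : {set V}) (lab : V -> option bool).
Hypothesis E_acyclic : acyclic E.

Local Notation reach := (connect E).

(** This is the form in which (N4) enters the recursion; [entering_arc_unique] supplies it. *)
Hypothesis entering : forall u v a b a' b', E u v ->
  E a b -> ~~ reach v a -> reach v b -> (a, b) != (u, v) ->
  E a' b' -> ~~ reach v a' -> reach v b' -> (a', b') != (u, v) ->
  (a, b) = (a', b').
Hypothesis leaf_sink : forall x y, x \in X -> ~~ E x y.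

(** The explained graph as a relation on all vertices of the network, so that sequences over [V] can
    be used instead of the subtype of leaves. *)
Definition leaf_adj : rel V := [rel x y | [&& x \in X, y \in X, x != y &
  [exists v, is_lca E x y v && (lab v == Some true)]]].

Hypothesis C4_free : forall a b c d, leaf_adj a b -> leaf_adj b c ->
  leaf_adj c d -> leaf_adj d a -> a != c -> b != d -> leaf_adj a c || leaf_adj b d.

Lemma leaf_adj_sym : symmetric leaf_adj.
Proof.
move=> x y; rewrite /leaf_adj /= eq_sym andbCA; congr [&& _, _, _ & _].
have caC u v w : common_ancestor E u v w = common_ancestor E v u w.
  exact: andbC.
apply: eq_existsb => v; congr ((_ == _) && _); apply/setP => u.
rewrite !inE /min_common_ancestor caC; congr (_ && _).
by apply: eq_forallb => w; rewrite caC.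
Qed.

(** A common ancestor below all the others is the unique minimal one, so its label decides. *)
Lemma leaf_adj_lca x y v : x \in X -> y \in X -> x != y ->
  reach v x -> reach v y -> (forall w, reach w x -> reach w y -> reach w v) ->
  leaf_adj x y = (lab v == Some true).
Proof.
move=> xX yX xy vx vy vmin.
have lca : is_lca E x y v.
  apply/eqP/setP => w; rewrite !inE; apply/andP/eqP => [[/andP[wx wy]]|->].
    move=> /forallP/(_ v)/implyP; rewrite /common_ancestor vx vy => /(_ isT).
    by move=> /implyP/(_ (vmin w wx wy))/eqP.
  rewrite /common_ancestor vx vy; split=> //; apply/forallP => u.
  apply/implyP => /andP[ux uy]; apply/implyP => vu.
  by rewrite (reach_anti E_acyclic vu (vmin u ux uy)).
rewrite /leaf_adj /= xX yX xy /=; apply/existsP/idP => [[w /andP[]]|tv].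
  by rewrite /is_lca (eqP lca) => /eqP/set1_inj ->.
by exists v; rewrite lca.
Qed.

Definition below (c : V) : {set V} := [set w | reach c w].
Definition below_set (F : {set V}) : {set V} := [set w | [exists c in F, reach c w]].

Lemma below_setP (F : {set V}) w :
  reflect (exists2 c, c \in F & reach c w) (w \in below_set F).
Proof. by rewrite inE; apply: exists_inP. Qed.

Lemma mem_below_set (F : {set V}) c : c \in F -> c \in below_set F.
Proof. by move=> cF; apply/below_setP; exists c. Qed.

Lemma below_set_closed (F : {set V}) x y :
  reach x y -> x \in below_set F -> y \in below_set F.
Proof.
move=> xy /below_setP[c cF cx]; apply/below_setP; exists c => //.
exact: connect_trans cx xy.
Qed.

Lemma below_set1 c : below_set [set c] = below c.
Proof.
apply/setP => w; rewrite [RHS]inE; apply/below_setP/idP => [[d /set1P->]|] //.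
by exists c; rewrite ?set11.
Qed.

Definition intervalizable (S : {set V}) : Prop :=
  exists s, [/\ uniq s, s =i X :&: S & iord leaf_adj s].

(* The children [F] of [v] are a union of whole branches and whole galls at [v]. *)
Definition gated (v : V) (F : {set V}) : Prop :=
  (forall c, c \in F -> E v c) /\
  forall x y, E x y -> x \notin below_set F -> y \in below_set F ->
    x = v /\ y \in F.

Lemma gated_notin v F : gated v F -> v \notin below_set F.
Proof.
move=> [Fv _]; apply/below_setP => -[c /Fv vc cv].
by have := arcNreach E_acyclic vc; rewrite cv.
Qed.

Lemma gated_reach v F x y :
  gated v F -> reach x y -> x \notin below_set F -> y \in below_set F -> reach x v.
Proof.
move=> [_ Fg] xy xF yF.
have [a [b [xa ab _ aF bF]]] := @reach_enter _ E (mem (below_set F)) x y xy xF yF.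
by have [<- _] := Fg a b ab aF bF.
Qed.

(** Leaves on different sides of the split have lca [v], so the two parts are joined or separated
    according to its label, and [join_iord] merges their orders. *)
Lemma intervalizable_split v F F1 : gated v F -> gated v F1 -> F1 \subset F ->
  intervalizable (below_set F1) ->
  (gated v (F :\: F1) -> [disjoint below_set F1 & below_set (F :\: F1)] ->
    intervalizable (below_set (F :\: F1))) ->
  intervalizable (below_set F).
Proof.
move=> gF gF1 /subsetP sub [s1 [u1 m1 io1]] IH.
have [Fv Fg] := gF; have [F1v F1g] := gF1.
(* A child outside [F1] reaching into [below_set F1] from outside would have to pass through its own
   parent [v]. *)
have dis x : x \in below_set F1 -> x \in below_set (F :\: F1) -> False.
  move=> x1 /below_setP[c]; rewrite inE => /andP[cF1 cF] cx.
  have [c1|c1] := boolP (c \in below_set F1).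
    have [_ cF1'] := F1g v c (Fv c cF) (gated_notin gF1) c1.
    by rewrite cF1' in cF1.
  have cv := gated_reach gF1 cx c1 x1.
  by have := arcNreach E_acyclic (Fv c cF); rewrite cv.
have cover x : x \in below_set F ->
    (x \in below_set F1) || (x \in below_set (F :\: F1)).
  move=> /below_setP[c cF cx]; apply/orP.
  have [cF1|cF1] := boolP (c \in F1); [left|right]; apply/below_setP; exists c => //.
  by rewrite inE cF1.
have sub1 x : x \in below_set F1 -> x \in below_set F.
  by move=> /below_setP[c /sub cF cx]; apply/below_setP; exists c.
have sub2 x : x \in below_set (F :\: F1) -> x \in below_set F.
  move=> /below_setP[c]; rewrite inE => /andP[_ cF] cx.
  by apply/below_setP; exists c.
have g2 : gated v (F :\: F1).
  split=> [c|x y xy x2 y2]; first by rewrite inE => /andP[_ /Fv].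
  have xF : x \notin below_set F.
    apply/negP => /cover; rewrite (negPf x2) orbF => x1.
    by apply: (dis y) => //; apply: below_set_closed (connect1 xy) x1.
  have [-> yF] := Fg x y xy xF (sub2 y y2); split=> //.
  rewrite inE yF andbT; apply/negP => yF1.
  by apply: (dis y) => //; apply: mem_below_set.
have [|s2 [u2 m2 io2]] := IH g2.
  by apply/pred0P => x /=; apply/negP => /andP[]; apply: dis.
have u12 : uniq (s1 ++ s2).
  rewrite cat_uniq u1 u2 andbT; apply/hasPn => x; rewrite m2 /= m1 !inE.
  move=> /andP[-> x2] /=; apply/negP => x1; apply: (@dis x); last by rewrite inE.
  by rewrite inE.
have j : joined leaf_adj (lab v == Some true) s1 s2.
  apply/allrelP => x y; rewrite m1 m2 => /setIP[xX x1] /setIP[yX y2]; apply/eqP.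
  have reachv z : z \in below_set F -> reach v z.
    by case/below_setP => c /Fv vc; apply: connect_trans (connect1 vc).
  apply: leaf_adj_lca => //.
  - by apply/negP => /eqP xy; apply: (@dis x) => //; rewrite xy.
  - exact/reachv/sub1.
  - exact/reachv/sub2.
  - move=> w wx wy; have [/cover/orP[w1|w2]|wF] := boolP (w \in below_set F).
    + by case: (@dis y) => //; apply: below_set_closed wy w1.
    + by case: (@dis x) => //; apply: below_set_closed wx w2.
    + exact: gated_reach gF wx wF (sub1 x x1).
have [s [ps ios]] := join_iord leaf_adj_sym C4_free u12 io1 io2 j.
exists s; split=> //; first by rewrite (perm_uniq ps).
move=> x; rewrite (perm_mem ps) mem_cat m1 m2 !in_setI -andb_orr; congr (_ && _).
by apply/idP/idP => [/orP[/sub1|/sub2]|/cover].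
Qed.

(** * The induction step: single branches and galls *)

Section InductionStep.

Variable n : nat.
Hypothesis IHn : forall v F, gated v F -> #|below_set F| < n ->
  intervalizable (below_set F).

Lemma below_out c w : w \in below c -> w = c \/ w \in below_set (out_nbrs E c).
Proof.
rewrite inE => cw; have [->|nwc] := eqVneq w c; [by left|right].
have [|d cd dw] := reach_first cw; first by rewrite eq_sym.
by apply/below_setP; exists d => //; rewrite inE.
Qed.

Lemma card_below_out c : #|below_set (out_nbrs E c)| < #|below c|.
Proof.
apply: proper_card; apply/properP; split.
  apply/subsetP => w /below_setP[d]; rewrite !inE => cd.
  exact: connect_trans (connect1 cd).
exists c; first by rewrite inE.
apply/below_setP => -[d]; rewrite inE => cd dc.
by have := arcNreach E_acyclic cd; rewrite dc.
Qed.

(** Unless [c] is a leaf, the leaves below [c] are those below its children, which are gated because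
    [below c] is entered at [c] only. *)
Lemma intervalizable_below c : #|below c| <= n ->
  (forall x y, E x y -> ~~ reach c x -> reach c y -> y = c) ->
  intervalizable (below c).
Proof.
move=> lec gc; have cN : c \notin below_set (out_nbrs E c).
  apply/below_setP => -[d]; rewrite inE => cd dc.
  by have := arcNreach E_acyclic cd; rewrite dc.
have sub w : w \in below_set (out_nbrs E c) -> w \in below c.
  by move=> /below_setP[d]; rewrite !inE => cd; apply: connect_trans (connect1 cd).
have [cX|cX] := boolP (c \in X).
  exists [:: c]; split=> // w; rewrite !inE; apply/eqP/andP => [->|[wX cw]] //.
  have wc : w \in below c by rewrite inE.
  case: (below_out wc) => // /below_setP[d].
  by rewrite inE (negPf (leaf_sink d cX)).
have gated_c : gated c (out_nbrs E c).
  split=> [d|x y xy xc yc]; first by rewrite inE.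
  have [/below_out[xE|xc']|xc'] := boolP (x \in below c).
  - by rewrite -xE inE.
  - by rewrite xc' in xc.
  - have yE : y = c.
      apply: (gc x y xy); first by move: xc'; rewrite inE.
      by move/sub: yc; rewrite inE.
    by rewrite yE (negPf cN) in yc.
have [s [us ms ios]] := IHn gated_c (leq_trans (card_below_out c) lec).
exists s; split=> // w; rewrite ms !in_setI; apply/andP/andP => -[wX wc].
  by split=> //; apply: sub.
by split=> //; case: (below_out wc) => // wE; rewrite -wE wX in cX.
Qed.

(* Walking down a side of a gall from [u] to the hybrid [b], whose other parent
   is [a]. *)
Lemma gall_side_chain w u a b h : #|below u| <= n -> E w u -> E a b ->
  ~~ reach u a -> reach u b -> h =i X :&: below b ->
  exists ch, [/\ chain leaf_adj h ch, uniq (chain_body ch) &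
    chain_body ch =i X :&: (below u :\: below b)].
Proof.
move=> + + ab + + hE; have [m] := ubnP #|below u|.
elim: m w u => // m IH w u ltm leu wu ua ub.
have [uE|uNb] := eqVneq u b.
  exists [::]; split=> // x.
  by rewrite uE setDv setI0 inE.
have [c uc cb] := reach_first ub uNb.
have subc x : reach c x -> reach u x by apply: connect_trans (connect1 uc).
have ca : ~~ reach c a by apply: contraNN ua; apply: subc.
have nuc : (a, b) != (u, c) by apply: contraNneq ua => -[-> _].
(* By [entering], the gall leaves no third arc into [below c]. *)
have entc x y : E x y -> ~~ reach c x -> reach c y ->
    (x, y) = (u, c) \/ (x, y) = (a, b).
  move=> xy cx cy; case: (eqVneq (x, y) (u, c)) => [|nxy]; [by left|right].
  exact: entering uc xy cx cy nxy ab ca cb nuc.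
have entu x y : E x y -> ~~ reach u x -> reach u y ->
    y = u \/ (x, y) = (a, b).
  move=> xy ux uy; case: (eqVneq (x, y) (w, u)) => [[_ ->]|nxy]; [by left|right].
  apply: entering wu xy ux uy nxy ab ua ub _.
  by rewrite xpair_eqE [b == u]eq_sym (negPf uNb) andbF.
(* The children of [u] off the side carry the module of [u]; it is disjoint from [below c] and
   gated, so [IHn] orders it. *)
pose F := out_nbrs E u :\ c.
have Fu d : d \in F -> E u d /\ d != c by rewrite !inE => /andP[].
have dis x : x \in below_set F -> reach c x -> False.
  move=> /below_setP[d /Fu[ud dc] dx] cx.
  have [cd|cd] := boolP (reach c d).
    have [|[]|[]] := entc u d ud _ cd; first exact: arcNreach uc.
      by move/eqP: dc.
    by move=> ua'; rewrite -ua' connect0 in ua.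
  have [x' [y' [dx' xy' _ cx' cy']]] := @reach_enter _ E (reach c) d x dx cd cx.
  have [[xE _]|[xE _]] := entc x' y' xy' cx' cy'.
    by have := arcNreach E_acyclic ud; rewrite -xE dx'.
  by move/negP: ua; apply; rewrite -xE; apply: connect_trans (connect1 ud) dx'.
have split_u x : reach u x -> [\/ x = u, reach c x | x \in below_set F].
  move=> ux; have [->|xu] := eqVneq x u; first by constructor 1.
  have [|d ud dx] := reach_first ux; first by rewrite eq_sym.
  have [dc|dc] := eqVneq d c; first by constructor 2; rewrite -dc.
  by constructor 3; apply/below_setP; exists d; rewrite // !inE dc.
have subF x : x \in below_set F -> reach u x.
  by move=> /below_setP[d /Fu[ud _]]; apply: connect_trans (connect1 ud).
have uF : u \notin below_set F.
  apply/below_setP => -[d /Fu[ud _] du].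
  by have := arcNreach E_acyclic ud; rewrite du.
have gF : gated u F.
  split=> [d /Fu[] //|x y xy xF yF].
  have [/split_u[xE|cx|xF']|ux] := boolP (reach u x).
  - subst x; split=> //; rewrite !inE xy andbT.
    by apply/eqP => yc; apply: (dis y yF); rewrite yc connect0.
  - by case: (dis y yF); apply: connect_trans cx (connect1 xy).
  - by rewrite xF' in xF.
  - have [yE|[_ yE]] := entu x y xy ux (subF y yF).
      by rewrite yE (negPf uF) in yF.
    by case: (dis y yF); rewrite yE.
have ltF : #|below_set F| < #|below u|.
  apply: proper_card; apply/properP; split.
    by apply/subsetP => x /subF; rewrite inE.
  by exists u; rewrite // inE.
have ltc : #|below c| < #|below u|.
  apply: proper_card; apply/properP; split.
    by apply/subsetP => x; rewrite !inE => /subc.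
  by exists u; rewrite !inE // (arcNreach E_acyclic uc).
have [ms [ums mms ioms]] := IHn gF (leq_trans ltF leu).
have [ch [chh uch mch]] :=
  IH u c (leq_trans ltc ltm) (leq_trans (ltnW ltc) leu) uc ca cb.
have bodyE x : x \in chain_body ch ++ h -> x \in X /\ reach c x.
  rewrite mem_cat mch hE !inE => /orP[/and3P[-> _ ->]|/andP[-> bx]] //.
  by split=> //; apply: connect_trans cb bx.
exists ((lab u == Some true, ms) :: ch); split=> /=.
- rewrite ioms chh andbT /=; apply/allrelP => x y; rewrite mms => /setIP[xX xF].
  move=> /bodyE[yX cy]; apply/eqP; apply: leaf_adj_lca => //.
  + by apply/eqP => xy; apply: (dis x xF); rewrite xy.
  + exact: subF.
  + exact: subc.
  + move=> z zx zy; have [/split_u[->//|cz|zF]|uz] := boolP (reach u z).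
    * by case: (dis x xF); apply: connect_trans cz zx.
    * by case: (dis y _ cy); apply: below_set_closed zy zF.
    (* From outside, [below u] is entered at [u] or at [b]; entering at [b] cannot lead to [x],
       which is not below [c]. *)
    * have [x' [y' [zx' xy' yx' ux' uy']]] :=
        @reach_enter _ E (reach u) z x zx uz (subF x xF).
      have [yE|[_ yE]] := entu x' y' xy' ux' uy'.
        by apply: connect_trans zx' _; rewrite -yE connect1.
      by case: (dis x xF); apply: connect_trans cb _; rewrite -yE.
- rewrite /chain_body /= cat_uniq ums uch andbT; apply/hasPn => x xch /=.
  rewrite mms; apply/negP => /setIP[_ xF].
  have [|_ cx] := bodyE x; first by rewrite mem_cat xch.
  exact: dis xF cx.
- move=> x; rewrite /chain_body /= mem_cat -/(chain_body ch) mms mch.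
  rewrite !in_setI !in_setD -andb_orr; case xX: (x \in X) => //=.
  rewrite ![x \in below _]inE; apply/idP/idP.
    move=> /orP[xF|/andP[-> /subc] //]; rewrite (subF x xF) andbT.
    by apply/negP => bx; apply: (dis x xF); apply: connect_trans cb bx.
  move=> /andP[bx /split_u[xE|cx|->//]]; last by rewrite bx cx orbT.
  by rewrite xE in xX; have := leaf_sink c xX; rewrite uc.
Qed.

(* The source [b] of the common part of [below c] and [below d] is the hybrid of
   the gall with top [v] through [c] and [d]; its in-arcs already account for all
   arcs that may enter [below c], [below d] and [below b]. *)
Lemma gall_hybrid v c d z : E v c -> E v d -> c != d -> reach c z -> reach d z ->
  exists b p q, [/\ reach c b, reach d b,
    [/\ E p b, ~~ reach d p & p = v /\ b = c \/ reach c p],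
    [/\ E q b, ~~ reach c q & q = v /\ b = d \/ reach d q] & p != q].
Proof.
move=> vc vd cd cz dz.
have [b /andP[cb db] bsrc] := reach_source E_acyclic
  (I := fun w => reach c w && reach d w) (introT andP (conj cz dz)).
have parent c' d' : E v c' -> E v d' -> reach c' b -> reach d' b ->
    (forall a, reach c' a -> reach d' a -> reach a b -> a = b) ->
    exists p, [/\ E p b, ~~ reach d' p & p = v /\ b = c' \/ reach c' p].
  move=> vc' vd' cb' db' src; have [bc|bc] := eqVneq c' b.
    exists v; rewrite -bc vc' (arcNreach E_acyclic vd').
    by split=> //; left.
  have [p cp pb] := reach_last cb' bc; exists p; split=> //; last by right.
  apply/negP => dp; have pE := src p cp dp (connect1 pb).
  by have := arcNreach E_acyclic pb; rewrite pE connect0.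
have [|p [pb dp pc]] := parent c d vc vd cb db.
  by move=> a ca da; apply: bsrc; rewrite ca da.
have [|q [qb cq qd]] := parent d c vd vc db cb.
  by move=> a da ca; apply: bsrc; rewrite ca da.
exists b, p, q; split=> //; apply/eqP => pq; subst q.
case: pc => [[_ bc]|cp]; last by rewrite cp in cq.
case: qd => [[_ bd]|dp']; last by rewrite dp' in dp.
by rewrite -bc bd eqxx in cd.
Qed.

(** The hybrid [b] accounts for all arcs entering [below c], [below d] and [below b]. Hence
    [below c] and [below d] meet exactly in [below b], both sides are chains over the leaves of [b],
    and [gall_iord] applies with the label of [v]. *)
Lemma gall_intervalizable v c d z : E v c -> E v d -> c != d ->
  reach c z -> reach d z -> #|below_set [set c; d]| <= n ->
  gated v [set c; d] /\ intervalizable (below_set [set c; d]).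
Proof.
move=> vc vd cd cz dz len.
have [b [p [q [cb db [pb dp pP] [qb cq qP] pq]]]] := gall_hybrid vc vd cd cz dz.
have nqb : (q, b) != (v, c).
  apply/eqP => -[qv bc]; case: qP => [[_ bd]|]; first by rewrite -bc bd eqxx in cd.
  by rewrite qv (negPf (arcNreach E_acyclic vd)).
have npb : (p, b) != (v, d).
  apply/eqP => -[pv bd]; case: pP => [[_ bc]|]; first by rewrite -bc bd eqxx in cd.
  by rewrite pv (negPf (arcNreach E_acyclic vc)).
have entc x y : E x y -> ~~ reach c x -> reach c y ->
    (x, y) = (v, c) \/ (x, y) = (q, b).
  move=> xy cx cy; case: (eqVneq (x, y) (v, c)) => [|nxy]; [by left|right].
  exact: entering vc xy cx cy nxy qb cq cb nqb.
have entd x y : E x y -> ~~ reach d x -> reach d y ->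
    (x, y) = (v, d) \/ (x, y) = (p, b).
  move=> xy dx dy; case: (eqVneq (x, y) (v, d)) => [|nxy]; [by left|right].
  exact: entering vd xy dx dy nxy pb dp db npb.
have entb x y : E x y -> ~~ reach b x -> reach b y -> y = b.
  move=> xy bx bY; case: (eqVneq (x, y) (p, b)) => [[_ ->] //|nxy].
  have [] : (x, y) = (q, b); last by [].
  apply: entering pb xy bx bY nxy qb (arcNreach E_acyclic qb) (connect0 _ _) _.
  by rewrite xpair_eqE eqxx andbT eq_sym.
have cdP x : reflect (reach c x \/ reach d x) (x \in below_set [set c; d]).
  apply: (iffP (below_setP _ _)) => [[y /set2P[]-> ]|]; try by [left|right].
  by case=> [cx|dx]; [exists c|exists d]; rewrite // !inE eqxx ?orbT.
have vN y : E v y -> ~~ reach y v by apply: arcNreach.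
have g : gated v [set c; d].
  split=> [y /set2P[]-> //|x y xy xcd /cdP ycd].
  have [cx dx] : ~~ reach c x /\ ~~ reach d x.
    by split; apply: contraNN xcd => ?; apply/cdP; [left|right].
  case: ycd => [cy|dy].
    case: (entc x y xy cx cy) => -[xE ->]; first by rewrite xE !inE eqxx.
    case: qP => [[qv ->]|dq]; first by rewrite xE qv !inE eqxx orbT.
    by rewrite xE dq in dx.
  case: (entd x y xy dx dy) => -[xE ->]; first by rewrite xE !inE eqxx orbT.
  case: pP => [[pv ->]|cp]; first by rewrite xE pv !inE eqxx.
  by rewrite xE cp in cx.
split=> //.
(* Either [d] is already below [c], which forces [d] to be [b], or a path from [d] to [x] enters
   [below c], necessarily at [b]. *)
have interb x : reach c x -> reach d x -> reach b x.
  move=> cx dx; have [dc|dc] := boolP (reach c d).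
    have [[] /eqP|[_ <-//]] := entc v d vd (vN c vc) dc.
    by rewrite eq_sym (negPf cd).
  have [x' [y' [dx' xy' yx' cx' cy']]] := @reach_enter _ E (reach c) d x dx dc cx.
  have [[xE _]|[_ <- //]] := entc x' y' xy' cx' cy'.
  by have := vN d vd; rewrite -xE dx'.
have le_sub y : y \in [set c; d] -> #|below y| <= n.
  move=> ycd; apply: leq_trans len; apply: subset_leq_card.
  apply/subsetP => x; rewrite [x \in below y]inE => yx.
  by apply/below_setP; exists y.
have leb : #|below b| <= n.
  apply: leq_trans (le_sub c _); last by rewrite !inE eqxx.
  apply: subset_leq_card; apply/subsetP => x; rewrite !inE.
  exact: connect_trans.
have [h [uh mh ioh]] := intervalizable_below leb entb.
have [|ch1 [chh1 u1 m1]] := gall_side_chain (le_sub c _) vc qb cq cb mh.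
  by rewrite !inE eqxx.
have [|ch2 [chh2 u2 m2]] := gall_side_chain (le_sub d _) vd pb dp db mh.
  by rewrite !inE eqxx orbT.
have u : uniq (chain_body ch1 ++ chain_body ch2 ++ h).
  rewrite cat_uniq u1 cat_uniq u2 uh /= andbT.
  apply/andP; split; apply/hasPn => x /=; last first.
    by rewrite mh m2 !inE => /andP[_ ->]; rewrite andbF.
  rewrite mem_cat mh m1 m2 !inE => /orP[/and3P[_ bx dx]|/andP[_ ->]].
    by apply/negP => /and3P[_ _ cx]; rewrite interb in bx.
  by rewrite andbF.
have j : joined leaf_adj (lab v == Some true) (chain_body ch1) (chain_body ch2).
  apply/allrelP => x y; rewrite m1 m2 !inE.
  move=> /and3P[xX bx cx] /and3P[yX bY dy]; apply/eqP; apply: leaf_adj_lca => //.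
  - by apply: contraNneq bx => xy; apply: interb; rewrite // xy.
  - exact: connect_trans (connect1 vc) cx.
  - exact: connect_trans (connect1 vd) dy.
  - move=> w wx wy; have [/cdP[cw|dw]|wN] := boolP (w \in below_set [set c; d]).
    + by case/negP: bY; apply: interb => //; apply: connect_trans cw wy.
    + by case/negP: bx; apply: interb => //; apply: connect_trans dw wx.
    + by apply: gated_reach g wx wN _; apply/cdP; left.
have [s [ps ios]] := gall_iord leaf_adj_sym C4_free u ioh chh1 chh2 j.
exists s; split=> //; first by rewrite (perm_uniq ps).
move=> x; rewrite (perm_mem ps) !mem_cat m1 m2 mh !in_setI !in_setD -!andb_orr.
congr (_ && _); rewrite ![x \in below _]inE.
apply/idP/cdP => [/or3P[/andP[_ ->]|/andP[_ ->]|bx]|]; [by left|by right| |].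
  by left; apply: connect_trans cb bx.
by have [bx|bx] := boolP (reach b x); rewrite ?orbT //= => -[->|->]; rewrite ?orbT.
Qed.

End InductionStep.

(** A child [c] is split off, together with a child [d] sharing a descendant with it if there is
    one; what is left is smaller. *)
Theorem gated_intervalizable v F : gated v F -> intervalizable (below_set F).
Proof.
have [n] := ubnP #|below_set F|; elim: n v F => // n IHn v F ltF gF.
have IH' v' F' : gated v' F' -> #|below_set F'| < n -> intervalizable (below_set F').
  by move=> g' lt'; apply: IHn g'.
have [Fv Fg] := gF.
have [F0|[c cF]] := set_0Vmem F.
  exists [::]; split=> // x; rewrite in_nil; apply/esym/negbTE/negP.
  by case/setIP=> _ /below_setP[d]; rewrite F0 inE.
have le_sub (F' : {set V}) : F' \subset F -> #|below_set F'| <= #|below_set F|.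
  move=> /subsetP sub; apply: subset_leq_card; apply/subsetP => x.
  by move=> /below_setP[d /sub dF dx]; apply/below_setP; exists d.
have split_c (F1 : {set V}) : c \in F1 -> F1 \subset F -> gated v F1 ->
    intervalizable (below_set F1) -> intervalizable (below_set F).
  move=> cF1 sub g1 i1; apply: (intervalizable_split gF g1 sub i1) => g2 dis.
  apply: IHn g2; rewrite ltnS in ltF; apply: leq_trans ltF; apply: proper_card.
  apply/properP; split.
    apply/subsetP => x /below_setP[d]; rewrite inE => /andP[_ dF] dx.
    by apply/below_setP; exists d.
  exists c; first exact: mem_below_set.
  by rewrite (disjointFr dis (mem_below_set cF1)).
have [/exists_inP[d dF /andP[dc /existsP[z /andP[cz dz]]]]|nod] :=
    boolP [exists d in F, (d != c) && [exists z, reach c z && reach d z]].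
  have sub : [set c; d] \subset F by apply/subsetP => x /set2P[]->.
  have lecd : #|below_set [set c; d]| <= n.
    by apply: leq_trans (le_sub _ sub) _.
  rewrite eq_sym in dc.
  have [g1 i1] := gall_intervalizable IH' (Fv c cF) (Fv d dF) dc cz dz lecd.
  by apply: split_c sub g1 i1; rewrite !inE eqxx.
have nodP d x : d \in F -> reach c x -> reach d x -> d = c.
  move=> dF cx dx; apply/eqP; apply: contraT => dc.
  case/negP: nod; apply/exists_inP; exists d; rewrite // dc.
  by apply/existsP; exists x; rewrite cx.
have sub : [set c] \subset F by rewrite sub1set.
have gc : gated v [set c].
  split=> [d /set1P->|x y xy]; first exact: Fv.
  rewrite below_set1 !inE => cx cy.
  have yF : y \in below_set F by apply/below_setP; exists c.
  have xF : x \notin below_set F.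
    apply/negP => /below_setP[d dF dx].
    have dE := nodP d y dF cy (connect_trans dx (connect1 xy)).
    by rewrite -dE dx in cx.
  by have [-> {}yF] := Fg x y xy xF yF; rewrite (nodP y y yF cy (connect0 _ _)).
apply: (split_c _ _ sub gc); rewrite ?set11 // below_set1.
apply: (intervalizable_below IH').
  by rewrite -below_set1; apply: leq_trans (le_sub _ sub) _.
move=> x y xy cx cy; have [_ g] := gc.
by have [||_ /set1P] := g x y xy; rewrite ?below_set1 ?inE.
Qed.

End Decomposition.

(** * From orders to intervals and arcs *)

Section IntervalRepresentation.

Variables (G : sgraph) (rank : G -> nat).
Hypothesis rank_inj : injective rank.
Hypothesis rank_nbr : forall x y z, rank x < rank y -> rank y < rank z ->
  sedge x z -> sedge x y.

(** The right endpoint of the interval of [x], the left one being [rank x]. Counting [x] itself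
    keeps the interval nonempty. *)
Definition last_nbr_rank (x : G) : nat :=
  \max_(y | (y == x) || sedge x y) rank y.

Lemma rank_le_last x : rank x <= last_nbr_rank x.
Proof. by apply: (@leq_bigmax_cond _ _ rank x); rewrite eqxx. Qed.

(** The maximum is attained at some neighbour [z], and [rank_nbr] makes every vertex between [x] and
    [z] a neighbour too. *)
Lemma sedge_rank x y : rank x < rank y -> sedge x y = (rank y <= last_nbr_rank x).
Proof.
move=> ltxy; apply/idP/idP => [xy|].
  by apply: (@leq_bigmax_cond _ _ rank y); rewrite xy orbT.
have [|z Pz zE] := @eq_bigmax_cond _ [pred y | (y == x) || sedge x y] rank.
  by apply/card_gt0P; exists x; rewrite inE /= eqxx.
rewrite [last_nbr_rank x]zE; move: Pz; rewrite inE /= => Pz.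
move=> leyz; case/orP: Pz => [/eqP zx|xz]; first by rewrite zx leqNgt ltxy in leyz.
have [/rank_inj -> //|nyz] := eqVneq (rank y) (rank z).
by apply: rank_nbr ltxy _ xz; rewrite ltn_neqAle nyz.
Qed.

Lemma sedge_overlap x y : x != y ->
  sedge x y = (rank y <= last_nbr_rank x) && (rank x <= last_nbr_rank y).
Proof.
wlog ltxy : x y / rank x < rank y => [H|] xy.
  case: (ltngtP (rank x) (rank y)) => [| |/rank_inj xyE]; first by move/H; apply.
    by move=> /H Hyx; rewrite sedge_sym andbC Hyx // eq_sym.
  by rewrite xyE eqxx in xy.
rewrite sedge_rank //; have := leq_trans (ltnW ltxy) (rank_le_last y).
by move=> ->; rewrite andbT.
Qed.

Lemma rank_interval_graph : interval_graph G.
Proof.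
exists _, nat, (fun x => Interval (BLeft (rank x)) (BRight (last_nbr_rank x))).
split=> [x|x y xy].
  by exists (rank x); rewrite in_itv /= lexx leEnat rank_le_last.
rewrite sedge_overlap //; have lx := rank_le_last x; have ly := rank_le_last y.
split=> [/andP[yx xy']|[z []]].
  exists (maxn (rank x) (rank y)); rewrite !in_itv /= !leEnat !geq_max.
  by rewrite leq_maxl leq_maxr lx ly yx xy'.
rewrite !in_itv /= !leEnat => /andP[xz zx] /andP[yz zy].
by rewrite (leq_trans yz zx) (leq_trans xz zy).
Qed.

Local Open Scope ring_scope.
Local Open Scope classical_set_scope.

(* The interval model is scaled into angles in [0, 1], where [cos] is injective. *)
Lemma rank_circular_arc_graph (R : realType) : circular_arc_graph R G.
Proof.
pose M := (\max_(x : G) last_nbr_rank x).+1.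
have ltM x : (last_nbr_rank x < M)%N by rewrite ltnS leq_bigmax.
have M0 : 0 < M%:R :> R by rewrite ltr0n.
pose a x : R := (rank x)%:R / M%:R; pose b x : R := (last_nbr_rank x)%:R / M%:R.
have a0 x : 0 <= a x by rewrite divr_ge0.
have b1 x : b x <= 1 by rewrite ler_pdivrMr // mul1r ler_nat ltnW.
have pi2 := pi_ge2 R.
exists (fun x => [set (cos s, sin s) | s in [set s : R | a x <= s <= b x]]).
split=> [x|x y xy].
  exists (a x), (b x); split=> //.
    by rewrite ler_pM2r ?invr_gt0 // ler_nat rank_le_last.
  by have := a0 x; have := b1 x; lra.
have ab u v : (a u <= b v) = (rank u <= last_nbr_rank v)%N.
  by rewrite ler_pM2r ?invr_gt0 // ler_nat.
rewrite sedge_overlap // -!ab; split.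
  move=> /andP[ayx axy].
  exists (cos (Num.max (a x) (a y)), sin (Num.max (a x) (a y))).
  have aab u : a u <= b u by rewrite ab rank_le_last.
  by split; exists (Num.max (a x) (a y)) => //=;
    rewrite le_max ge_max lexx ?orbT aab ?ayx ?axy.
move=> [_ [[s /= /andP[xs sx] <-] [t /= /andP[yt ty] [ct _]]]].
have st : t = s.
  apply: cos_inj => //; rewrite in_itv /=; apply/andP; split.
  - exact: le_trans (a0 y) yt.
  - by have := b1 y; lra.
  - exact: le_trans (a0 x) xs.
  - by have := b1 x; lra.
by rewrite st in yt ty; rewrite (le_trans yt sx) (le_trans xs ty).
Qed.

End IntervalRepresentation.

(** * From the order on leaves to the GaTEx graph *)

Lemma iord_index (T : eqType) (e : rel T) s x y z : iord e s ->
  index x s < index y s -> index y s < index z s -> z \in s -> e x z -> e x y.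
Proof.
elim: s => //= a s IH /andP[ps ios].
case: (eqVneq a x) => [<-|ax]; case: (eqVneq a y) => [_|ay] //;
  case: (eqVneq a z) => [_|az] //.
  rewrite !ltnS => _ yz; rewrite inE eq_sym (negPf az) /= => zs.
  have ys : y \in s by rewrite -index_mem (ltn_trans yz) ?index_mem.
  have /(pairwiseP x)/(_ (index y s) (index z s)) := ps.
  by rewrite !inE !index_mem !nth_index // => /(_ ys zs yz)/implyP.
by rewrite !ltnS inE eq_sym (negPf az); apply: IH.
Qed.

Lemma galled_tree_intervalizable (N : labeled_galled_tree) :
  let e := leaf_adj (@gt_arc N) (gt_leaves N) (@gt_label N) in
  (forall a b c d, e a b -> e b c -> e c d -> e d a -> a != c -> b != d ->
    e a c || e b d) ->
  exists s, [/\ uniq s, s =i gt_leaves N & iord e s].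
Proof.
move=> e C4f; have [_ acy [[x [_ -> _]]|[r [rN1 XN2 rN3 EN4]]]] := gt_axioms N.
  by exists [:: x]; split=> // y; rewrite !inE.
have rX : r \notin gt_leaves N.
  by apply/negP => /XN2[r0 _]; have [[_]] := rN1; rewrite r0.
have reach_r := root_reach acy XN2 rN3.
have cover x : x \in gt_leaves N ->
    x \in below_set (@gt_arc N) (out_nbrs (@gt_arc N) r).
  move=> xX; have [|y ry yx] := reach_first (reach_r x).
    by apply: contraNneq rX => ->.
  by apply/below_setP; exists y; rewrite // inE.
have sink x y : x \in gt_leaves N -> ~~ gt_arc x y.
  move=> /XN2[/eqP]; rewrite cards_eq0 => /eqP/setP/(_ y).
  by rewrite !inE => ->.
(* Every vertex except [r] lies below a child of [r], so only arcs from [r] can enter. *)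
have gr : gated (@gt_arc N) r (out_nbrs (@gt_arc N) r).
  split=> [c|x y xy xr _]; first by rewrite inE.
  suff xE : x = r by rewrite -xE inE.
  apply/eqP; apply: contraNT xr => nxr.
  have [|c rc cx] := reach_first (reach_r x); first by rewrite eq_sym.
  by apply/below_setP; exists c; rewrite // inE.
have [s [us ms ios]] := gated_intervalizable acy
  (entering_arc_unique acy rN1 XN2 rN3 EN4) sink C4f gr.
exists s; split=> // x; rewrite ms in_setI.
by apply/andP/idP => [[] //|xX]; split=> //; apply: cover.
Qed.

Theorem mainTheorem14 (R : realType) (G : sgraph) :
  GaTEx G -> ~ induced_subgraph C4 G ->
  interval_graph G /\ circular_arc_graph R G.
Proof.
move=> [N [f [[g fK gK] fE]]] noC4.
pose e := leaf_adj (@gt_arc N) (gt_leaves N) (@gt_label N).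
have sE x y : sedge x y = e (val (f x)) (val (f y)).
  by rewrite -fE /= /explained_rel /= /e /leaf_adj /= !(valP (f _)).
have lift a : a \in gt_leaves N -> exists x, val (f x) = a.
  by move=> aX; exists (g (Sub a aX)); rewrite gK SubK.
have eX a b : e a b -> a \in gt_leaves N by case/andP.
have [|s [us ms ios]] := @galled_tree_intervalizable N; rewrite -/e.
  (* A chordless 4-cycle of [leaf_adj] is pulled back along [f] to an induced [C4] of [G]. *)
  move=> a b c d ab bc cd da ac bd.
  have [xa xaE] := lift a (eX _ _ ab); have [xb xbE] := lift b (eX _ _ bc).
  have [xc xcE] := lift c (eX _ _ cd); have [xd xdE] := lift d (eX _ _ da).
  apply: contraT; rewrite negb_or => /andP[/negPf nac /negPf nbd]; case: noC4.
  have esym u v : e u v = e v u by apply: leaf_adj_sym.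
  have irr u : e u u = false by rewrite /e /leaf_adj /= eqxx !andbF.
  exists (fun i : C4 => nth xa [:: xa; xb; xc; xd] i); split.
    have ne u v x y : val (f x) = u -> val (f y) = v -> e u v -> x != y.
      by move=> <- <-; apply: contraTneq => ->; rewrite irr.
    have ne' u v x y : val (f x) = u -> val (f y) = v -> u != v -> x != y.
      by move=> <- <-; apply: contraNneq => ->.
    have us : uniq [:: xa; xb; xc; xd].
      rewrite /= !inE !negb_or (ne _ _ _ _ xaE xbE ab) (ne' _ _ _ _ xaE xcE ac).
      rewrite [xa == xd]eq_sym (ne _ _ _ _ xdE xaE da) (ne _ _ _ _ xbE xcE bc).
      by rewrite (ne' _ _ _ _ xbE xdE bd) (ne _ _ _ _ xcE xdE cd).
    move=> i j /eqP; rewrite nth_uniq ?ltn_ord // => /eqP.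
    exact: val_inj.
  move=> [[|[|[|[|i]]]] lti] [[|[|[|[|j]]]] ltj] //=;
    rewrite sE ?xaE ?xbE ?xcE ?xdE ?irr ?ab ?bc ?cd ?da ?nac ?nbd //;
    by rewrite esym ?ab ?bc ?cd ?da ?nac ?nbd.
(* Positions in the leaf order serve as left endpoints. *)
pose rank x := index (val (f x)) s.
have ins x : val (f x) \in s by rewrite ms (valP (f x)).
have rank_inj : injective rank.
  move=> x y /(congr1 (nth (val (f x)) s)); rewrite !nth_index // => fxy.
  by apply: (can_inj fK); apply: val_inj.
have rank_nbr x y z : rank x < rank y -> rank y < rank z -> sedge x z -> sedge x y.
  by rewrite !sE => xy yz; apply: iord_index ios xy yz _.
split; first exact: rank_interval_graph rank_inj rank_nbr.
exact: rank_circular_arc_graph rank_inj rank_nbr R.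
Qed.
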